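(* Let $\Gamma$ be a Shilla distance-regular graph with $b(\Gamma)=b\geq 2$ and with eigenvalue multiplicities satisfying $m_2=m_3$. Then: (i) $a_3-b<b_2+c_2<a_3+b$; (ii) $c_2<b_2+b$; (iii) if $b_2+c_2=a_3$ or $b_2=c_2$, then $a_3=\frac{b(b-1)}{2}$.
   Context: A connected graph $\Gamma$ of diameter $D$ is distance-regular if there are integers $b_i,c_i$ ($0\le i\le D$) such that for any two vertices $x,y$ at distance $i$, exactly $c_i$ neighbours of $y$ are at distance $i-1$ from $x$ and exactly $b_i$ neighbours of $y$ are at distance $i+1$ from $x$. Then $\Gamma$ is regular of valency $k=b_0$, and $a_i:=k-b_i-c_i$. The eigenvalues of $\Gamma$ are those of its adjacency matrix; $\Gamma$ has exactly $D+1$ distinct eigenvalues $k=\theta_0>\theta_1>\dots>\theta_D$, and $m_i$ denotes the multiplicity of $\theta_i$. A Shilla distance-regular graph is a distance-regular graph of diameter $3$ whose second largest eigenvalue satisfies $\theta_1=a_3$. For such graphs $k=(a_3-a_1)a_3$, and one defines $b(\Gamma):=a_3-a_1=k/a_3$. *)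

(* Defs.v *)
From HB Require Import structures.
From mathcomp Require Import all_boot all_order all_algebra all_field.
Set Implicit Arguments. Unset Strict Implicit. Unset Printing Implicit Defensive.
Import Order.TTheory GRing.Theory Num.Theory.

Definition simple_graph (n : nat) (e : rel 'I_n) : Prop :=
  (forall x y, e x y = e y x) /\ (forall x, ~~ e x x).

Fixpoint walk (n : nat) (e : rel 'I_n) (x y : 'I_n) (k : nat) : bool :=
  match k with
  | 0 => x == y
  | k'.+1 => [exists z, e x z && walk e z y k']
  end.

Definition dist_is (n : nat) (e : rel 'I_n) (x y : 'I_n) (i : nat) : bool :=
  walk e x y i && [forall j : 'I_i, ~~ walk e x y j].

Definition drg_diam3 (n : nat) (e : rel 'I_n) (b c : nat -> nat) : Prop :=
  [/\ simple_graph e,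
      (forall x y, exists2 i, (i <= 3)%N & dist_is e x y i) /\
        (exists x y, dist_is e x y 3),
      c 0 = 0%N,
      (forall x y i, (1 <= i <= 3)%N -> dist_is e x y i ->
          #|[set z | e y z && dist_is e x z i.-1]| = c i) &
      (forall x y i, (i <= 3)%N -> dist_is e x y i ->
          #|[set z | e y z && dist_is e x z i.+1]| = b i)].

Definition drg_a (b c : nat -> nat) (i : nat) : int :=
  (b 0)%:Z - (b i)%:Z - (c i)%:Z.

Local Open Scope ring_scope.

Definition adjmx (n : nat) (e : rel 'I_n) : 'M[algC]_n :=
  \matrix_(i, j) (e i j)%:R.

Definition eigs_sorted (n : nat) (e : rel 'I_n) (k th1 th2 th3 : algC) : Prop :=
  [/\ th3 < th2, th2 < th1, th1 < k,
      (forall t, t \in [:: k; th1; th2; th3] -> eigenvalue (adjmx e) t) &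
      (forall t, eigenvalue (adjmx e) t -> t \in [:: k; th1; th2; th3])].

Definition mult (n : nat) (e : rel 'I_n) (t : algC) : nat :=
  \rank (eigenspace (adjmx e) t).

(* Main.v *)
(* Write a = a_3 and B = b(Gamma). Evaluating the three-term recurrences of the
   distance matrices on eigenvectors gives k = aB and shows that theta_2 and
   theta_3 are the roots of q(x) = x^2 - s x + p, where s = a - B - b_2 - c_2
   and p = B b_2 - aB + c_2. With m_2 = m_3 = m, the traces of 1, A, A^2
   only involve s and p; they determine m s and m (s + 2B) up to positive
   factors, and both have a definite sign, which is (i). Eliminating m leaves
   one polynomial relation between a, B, b_2, c_2. Part (ii) combines (i) with
   p^3_33 >= 0. In (iii) the relation leaves an integer (2 c_2 - a in both
   cases) that size estimates force to be 0. *)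
Require Import Defs.
From HB Require Import structures.
From mathcomp Require Import all_boot all_order all_algebra all_field.
From mathcomp Require Import ring zify.
Set Implicit Arguments. Unset Strict Implicit. Unset Printing Implicit Defensive.
Import Order.TTheory GRing.Theory Num.Theory.
Local Open Scope ring_scope.

(** * Spectra of normal matrices *)

Lemma mxrank_sum_le (F : fieldType) (n : nat) (I : finType) (P : pred I)
    (B : I -> 'M[F]_n) :
  (\rank (\sum_(i | P i) B i)%R <= \sum_(i | P i) \rank (B i))%N.
Proof.
apply: (big_ind2 (fun M r => \rank M <= r)%N) => [|M r M' r' le_r le_r'|//].
  by rewrite mxrank0.
exact: leq_trans (mxrank_add _ _) (leq_add le_r le_r').
Qed.

Lemma mxrank_diag_le (F : fieldType) (n : nat) (d : 'rV[F]_n) :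
  (\rank (diag_mx d) <= #|[pred i | d 0%R i != 0%R]|)%N.
Proof.
have -> : diag_mx d = \sum_(i | d 0 i != 0) d 0 i *: delta_mx i i.
  apply/matrixP => i j; rewrite summxE mxE.
  have [<-|neq_ij] := eqVneq i j; last first.
    rewrite mulr0n big1 // => k _; rewrite !mxE.
    by have [<-|] := eqVneq i k; rewrite ?mulr0 // eq_sym (negPf neq_ij) mulr0.
  have [di0|di_neq0] := eqVneq (d 0 i) 0.
    rewrite big1 ?di0 ?mul0rn // => k dk; rewrite !mxE.
    by case: eqP => [ik|]; rewrite ?mulr0 //; rewrite -ik di0 eqxx in dk.
  rewrite (bigD1 i) //= big1 ?addr0 => [|k /andP[_ /negPf k_neq]].
    by rewrite !mxE !eqxx mulr1.
  by rewrite !mxE eq_sym k_neq mulr0.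
apply: leq_trans (mxrank_sum_le _ _) _.
rewrite -sum1_card; apply: leq_sum => i di.
by rewrite (leq_trans (mxrank_scale _ _)) // mxrank_delta.
Qed.

(** For the lower bound, let [d'] be the indicator of the zeros of [d]. Then [d + d'] has no zero
    entry, so by subadditivity n is at most the wanted rank plus the number of zeros of [d]. *)
Lemma mxrank_diag (F : fieldType) (n : nat) (d : 'rV[F]_n) :
  \rank (diag_mx d) = #|[pred i | d 0%R i != 0%R]|.
Proof.
apply/eqP; rewrite eqn_leq mxrank_diag_le.
pose d' : 'rV[F]_n := \row_i (d 0 i == 0)%:R.
have unit_dd' : diag_mx (d + d') \in unitmx.
  rewrite unitmxE det_diag unitfE; apply/prodf_neq0 => i _; rewrite !mxE.
  by have [->|] := eqVneq (d 0 i) 0; rewrite ?add0r ?oner_neq0 ?addr0.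
have := mxrank_add (diag_mx d) (diag_mx d').
rewrite -raddfD (mxrank_unit unit_dd') => le_n.
have := leq_trans le_n (leq_add (leqnn _) (mxrank_diag_le d')).
rewrite -{1}[n]card_ord -(cardC [pred i | d 0 i != 0]).
have -> : #|[predC [pred i | d 0 i != 0]]| = #|[pred i | d' 0 i != 0]|.
  apply: eq_card => i; rewrite !inE !mxE negbK.
  by case: eqVneq; rewrite ?oner_neq0 ?eqxx.
by rewrite leq_add2r.
Qed.

Section NormalSpectrum.

Variables (C : numClosedFieldType) (n : nat) (A : 'M[C]_n).
Hypothesis normalA : A \is normalmx.

Let P := spectralmx A.
Let d := spectral_diag A.

Let unitP : P \in unitmx. Proof. exact: spectral_unit. Qed.

Let AE : A = invmx P *m diag_mx d *m P. Proof. exact/orthomx_spectralP. Qed.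

(** Unitary diagonalisation makes A - t conjugate to diag(d - t), whose rank counts the entries of
    [d] other than t; the eigenspace is its kernel. *)
Lemma mxrank_eigenspace_normal t :
  \rank (eigenspace A t) = #|[pred i | d 0 i == t]|.
Proof.
rewrite /eigenspace mxrank_ker.
have -> : A - t%:M = invmx P *m diag_mx (d - const_mx t) *m P.
  rewrite raddfB /= diag_const_mx mulmxBr mulmxBl -AE; congr (_ - _).
  by rewrite mul_mx_scalar -scalemxAl mulVmx // scalemx1.
rewrite mxrankMfree ?row_free_unit // -mxrank_tr trmx_mul mxrankMfree; last first.
  by rewrite row_free_unit unitmx_tr unitmx_inv.
rewrite tr_diag_mx mxrank_diag -{1}[n]card_ord.
rewrite -(cardC [pred i | d 0 i == t]).
rewrite (_ : #|[predC _]| = #|[pred i | (d - const_mx t) 0 i != 0]|) ?addnK //.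
by apply: eq_card => i; rewrite !inE !mxE subr_eq0.
Qed.

Lemma sum_spectrum (ts : seq C) (f : C -> C) :
  uniq ts -> (forall t, eigenvalue A t -> t \in ts) ->
  \sum_i f (d 0 i) = \sum_(t <- ts) f t *+ \rank (eigenspace A t).
Proof.
move=> uniq_ts ts_eig.
have d_ts i : d 0 i \in ts.
  apply: ts_eig; rewrite /eigenvalue -mxrank_eq0 mxrank_eigenspace_normal.
  by rewrite -lt0n; apply/card_gt0P; exists i; rewrite inE.
transitivity (\sum_(t <- ts) \sum_(i | d 0 i == t) f (d 0 i)); last first.
  apply: eq_bigr => t _; rewrite mxrank_eigenspace_normal -sumr_const.
  by apply: eq_bigr => i /eqP ->.
rewrite (exchange_big_dep predT) //=; apply: eq_bigr => i _.
under eq_bigl => t do rewrite eq_sym.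
by rewrite -big_filter filter_pred1_uniq ?big_seq1.
Qed.

(** These are [sum_spectrum] for f = 1, t and t^2; cyclicity of the trace removes the conjugating
    matrix. *)
Lemma tr_normal (ts : seq C) :
  uniq ts -> (forall t, eigenvalue A t -> t \in ts) ->
  [/\ n%:R = \sum_(t <- ts) (\rank (eigenspace A t))%:R :> C,
      \tr A = \sum_(t <- ts) t *+ \rank (eigenspace A t) &
      \tr (A *m A) = \sum_(t <- ts) t ^+ 2 *+ \rank (eigenspace A t)].
Proof.
move=> uts tsP; split.
- rewrite -(sum_spectrum (fun=> 1) uts tsP).
  by rewrite sumr_const card_ord.
- rewrite -(sum_spectrum id uts tsP) {1}AE -mulmxA mxtrace_mulC mulmxK //.
  exact: mxtrace_diag.
- rewrite -(sum_spectrum (fun t => t ^+ 2) uts tsP).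
  have -> : A *m A = invmx P *m (diag_mx d *m diag_mx d) *m P.
    by rewrite {1 2}AE !mulmxA mulmxK.
  rewrite -mulmxA mxtrace_mulC mulmxK // mulmx_diag mxtrace_diag.
  by apply: eq_bigr => i _; rewrite mxE.
Qed.

End NormalSpectrum.

(** * Distances and distance matrices *)

(** [walk] peels off its first edge, while c_i and b_i concern neighbours of the endpoint, so the
    last edge must be accessible too. *)
Lemma walkSr (n : nat) (e : rel 'I_n) (x y : 'I_n) (k : nat) :
  walk e x y k.+1 = [exists z, walk e x z k && e z y].
Proof.
elim: k x => [|k IHk] x.
  apply/existsP/existsP => -[z] /andP[] /=.
    by move=> exz /eqP <-; exists x; rewrite eqxx.
  by move=> /eqP <- exy; exists y; rewrite exy eqxx.
apply/existsP/existsP => -[z /andP[]].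
  move=> exz wzy.
  have := IHk z; rewrite [LHS]wzy => /esym/existsP[w /andP[wzw ewy]].
  by exists w; rewrite ewy andbT; apply/existsP; exists z; rewrite exz.
move=> /existsP[w /andP[exw wwz]] ezy; exists w; rewrite exw.
by apply: etrans (IHk w) _; apply/existsP; exists z; apply/andP.
Qed.

(** Searching in ['I_4] bounds the value by 3 outright. The default [ord0] is never reached in a
    graph of diameter 3, as [gdistP] shows. *)
Definition gdist (n : nat) (e : rel 'I_n) (x y : 'I_n) : nat :=
  odflt ord0 [pick i : 'I_4 | dist_is e x y i].

Section Graph.

Variables (n : nat) (e : rel 'I_n) (b c : nat -> nat).
Hypothesis drg_e : drg_diam3 e b c.

Local Notation d := (gdist e).

Let e_sym x y : e x y = e y x. Proof. by case: drg_e => -[]. Qed.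
Let e_irr x : ~~ e x x. Proof. by case: drg_e => -[]. Qed.

Lemma gdist_le3 x y : (d x y <= 3)%N. Proof. by rewrite -ltnS ltn_ord. Qed.

Lemma gdistP x y : dist_is e x y (d x y).
Proof.
rewrite /gdist; case: pickP => [i //|no_i].
have [_ [/(_ x y)[i le_i3 dxy] _] _ _ _] := drg_e.
by have := no_i (inord i); rewrite inordK ?ltnS // dxy.
Qed.

Lemma gdist_walk x y k : walk e x y k -> (d x y <= k)%N.
Proof.
rewrite leqNgt => wxy; apply/negP => lt_k.
have /andP[_ /forallP/(_ (Ordinal lt_k))] := gdistP x y.
by rewrite /= wxy.
Qed.

Lemma dist_isE x y i : dist_is e x y i = (d x y == i).
Proof.
apply/idP/eqP => [/andP[wxy /forallP no_lt]|<-]; last exact: gdistP.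
have := gdist_walk wxy; rewrite leq_eqVlt => /predU1P[//|lt_i].
have := no_lt (Ordinal lt_i).
by have /andP[-> _] := gdistP x y.
Qed.

Lemma gdist0 x y : (d x y == 0%N) = (x == y).
Proof.
by rewrite -dist_isE /dist_is /=; case: eqP => //= _; apply/forallP => -[].
Qed.

Lemma gdist1 x y : (d x y == 1%N) = e x y.
Proof.
rewrite -dist_isE; apply/andP/idP => [[/existsP[z /andP[exz /eqP <-]]]//|exy].
split; first by apply/existsP; exists y; rewrite exy eqxx.
apply/forallP => -[[|//] lt01] /=; apply: contraTneq exy => ->; exact: e_irr.
Qed.

Lemma gdist_nbr x y z : e y z -> (d x z <= (d x y).+1)%N.
Proof.
move=> eyz; apply: gdist_walk; rewrite walkSr; apply/existsP; exists y.
by rewrite eyz andbT; case/andP: (gdistP x y).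
Qed.

Lemma gdist_pred x y i : d x y = i.+1 -> exists2 z, e z y & d x z = i.
Proof.
move=> dxy; have /andP[] := gdistP x y; rewrite dxy walkSr.
case/existsP => z /andP[wxz ezy] _; exists z => //.
by apply/eqP; rewrite eqn_leq gdist_walk //= -ltnS -dxy gdist_nbr.
Qed.

Local Notation nbrs x y i := [set z | e y z && (d x z == i)].

Lemma card_nbrsS x y : #|nbrs x y (d x y).+1| = b (d x y).
Proof.
have [_ _ _ _ bP] := drg_e; rewrite -(bP x y) ?gdist_le3 ?gdistP //.
by apply: eq_card => z; rewrite !inE dist_isE.
Qed.

Lemma card_nbrs_pred x y : (0 < d x y)%N -> #|nbrs x y (d x y).-1| = c (d x y).
Proof.
have [_ _ _ cP _] := drg_e => d_gt0.
rewrite -(cP x y (d x y)) ?gdistP ?d_gt0 ?gdist_le3 //.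
by apply: eq_card => z; rewrite !inE dist_isE.
Qed.

Lemma card_nbrs y : #|[set z | e y z]| = b 0.
Proof.
have dyy : d y y = 0%N by apply/eqP; rewrite gdist0.
rewrite -dyy -card_nbrsS; apply: eq_card => z.
by rewrite !inE dyy gdist1 andbb.
Qed.

Lemma gdist_nbr_cases x y z : e y z ->
  [|| d x z == (d x y).+1, d x z == d x y | (0 < d x y)%N && (d x z == (d x y).-1)].
Proof.
move=> eyz; have := gdist_nbr x eyz; have := @gdist_nbr x z y.
by rewrite e_sym => /(_ eyz); lia.
Qed.

Lemma card_nbrs_eq x y : (#|nbrs x y (d x y)|%:Z = drg_a b c (d x y))%R.
Proof.
have := card_nbrs y.
rewrite -(cardsID [set z | d x z == (d x y).+1]).
rewrite -[X in (_ + X)%N](cardsID [set z | d x z == d x y]).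
rewrite (_ : _ :&: _ = nbrs x y (d x y).+1); last first.
  by apply/setP => z; rewrite !inE.
rewrite (_ : _ :&: _ = nbrs x y (d x y)); last first.
  by apply/setP => z; rewrite !inE; lia.
rewrite card_nbrsS /drg_a.
suff -> : #|[set z | e y z] :\: [set z | d x z == (d x y).+1]
              :\: [set z | d x z == d x y]| = c (d x y) by lia.
(* For x = y the truncated predecessor would again be 0; the class of closer neighbours is then
   empty, in agreement with c_0 = 0. *)
have [d0|d_gt0] := posnP (d x y).
  have [_ _ c0 _ _] := drg_e; rewrite d0 c0; apply: eq_card0 => z.
  rewrite !inE; apply/negP => /and3P[neq0 neq1 /(gdist_nbr_cases x)].
  by rewrite d0 (negPf neq0) (negPf neq1).
rewrite -card_nbrs_pred //; apply: eq_card => z; rewrite !inE.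
apply/and3P/andP => [[/negPf nE /negPf nS eyz]|[eyz /eqP ->]]; split=> //.
- by have := gdist_nbr_cases x eyz; rewrite nE nS d_gt0.
- by lia.
- by lia.
Qed.

Lemma b3_eq0 : b 3 = 0%N.
Proof.
have [_ [_ [x [y +]]] _ _ _] := drg_e; rewrite dist_isE => /eqP dxy.
rewrite -dxy -card_nbrsS; apply: eq_card0 => z; rewrite !inE dxy.
by have := gdist_le3 x z; lia.
Qed.

Lemma ex_path3 : exists x y1 y2 y3 : 'I_n,
  [/\ e y1 y2, e y2 y3, d x y1 = 1%N, d x y2 = 2%N & d x y3 = 3%N].
Proof.
have [_ [_ [x [y3 +]]] _ _ _] := drg_e; rewrite dist_isE => /eqP dx3.
have [y2 e23 dx2] := gdist_pred dx3; have [y1 e12 dx1] := gdist_pred dx2.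
by exists x, y1, y2, y3.
Qed.

Lemma drg_params :
  [/\ c 1 = 1%N, (0 < b 2)%N, (0 < c 2)%N & (0 < c 3)%N] /\
  (0 <= drg_a b c 1)%R /\ (0 <= drg_a b c 3)%R.
Proof.
have [x [y1 [y2 [y3 [e12 e23 dx1 dx2 dx3]]]]] := ex_path3; split; first split.
- rewrite -{1}dx1 -card_nbrs_pred dx1 //= -[RHS](cards1 x); apply: eq_card => z.
  rewrite !inE gdist0 [z == x]eq_sym; have [<-|] := eqVneq x z; rewrite ?andbF //.
  by rewrite e_sym -gdist1 dx1.
- rewrite -dx2 -card_nbrsS; apply/card_gt0P; exists y3.
  by rewrite inE e23 dx2 dx3.
- rewrite -dx2 -card_nbrs_pred ?dx2 //; apply/card_gt0P; exists y1.
  by rewrite inE e_sym e12 dx1.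
- rewrite -dx3 -card_nbrs_pred ?dx3 //; apply/card_gt0P; exists y2.
  by rewrite inE e_sym e23 dx2.
by split; [rewrite -dx1|rewrite -dx3]; rewrite -card_nbrs_eq.
Qed.

Definition distmx i : 'M[algC]_n := \matrix_(x, y) (d x y == i)%:R.

Local Notation A := (adjmx e).
Local Notation D := distmx.
Local Notation alpha i := ((drg_a b c i)%:~R : algC).
Local Notation ones := (const_mx 1 : 'M[algC]_n).

Lemma distmx_adjE i x y : (D i *m A) x y = #|nbrs x y i|%:R.
Proof.
rewrite mxE -sum1_card natr_sum [RHS]big_mkcond /=; apply: eq_bigr => z _.
by rewrite !mxE inE e_sym -natrM mulnb andbC; case: (_ && _).
Qed.

Lemma card_nbrs_eq0 x y i : i != (d x y).+1 -> i != d x y ->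
  (d x y == 0)%N || (i != (d x y).-1) -> #|nbrs x y i| = 0%N.
Proof.
move=> nS nE nP; apply: eq_card0 => z; rewrite !inE; apply/negP => /andP[eyz].
by have := gdist_nbr_cases x eyz; lia.
Qed.

Lemma distmx0 : D 0 = 1%:M.
Proof. by apply/matrixP => x y; rewrite !mxE gdist0. Qed.

Lemma distmx1 : D 1 = A.
Proof. by apply/matrixP => x y; rewrite !mxE gdist1. Qed.

(** The (x, y) entry counts the neighbours of y at distance i from x. It can be nonzero only if d(x,
    y) is i - 1, i or i + 1, and these cases give b_(i-1), a_i and c_(i+1). *)
Lemma distmx_adjS i : (i <= 3)%N ->
  D i *m A = (if i is j.+1 then (b j)%:R *: D j else 0) + alpha i *: D i +
    (c i.+1)%:R *: D i.+1.
Proof.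
move=> le_i3; apply/matrixP => x y; rewrite distmx_adjE !mxE.
have -> : (if i is j.+1 then (b j)%:R *: D j else 0 : 'M_n) x y
   = ((d x y).+1 == i)%:R * (b (d x y))%:R.
  case: i {le_i3} => [|j]; rewrite !mxE ?mul0r // eqSS.
  by have [->|] := eqVneq (d x y) j; rewrite ?mulr1 ?mul1r ?mulr0 ?mul0r.
have dS : (d x y).+1 = i -> #|nbrs x y i| = b (d x y).
  by move=> <-; apply: card_nbrsS.
have dE : d x y = i -> #|nbrs x y i|%:R = alpha i.
  by move=> <-; rewrite -card_nbrs_eq.
have dP : d x y = i.+1 -> #|nbrs x y i| = c i.+1.
  by move=> dxy; rewrite -dxy -card_nbrs_pred dxy.
have [dxS|nS] := (d x y).+1 =P i.
  have /negPf-> : d x y != i by lia.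
  have /negPf-> : d x y != i.+1 by lia.
  by rewrite dS // mul1r !mulr0 !addr0.
have [dxE|nE] := d x y =P i.
  have /negPf-> : d x y != i.+1 by lia.
  by rewrite dE // mul0r mulr1 mulr0 add0r addr0.
have [dxP|nP] := d x y =P i.+1; first by rewrite dP // mul0r mulr1 mulr0 !add0r.
by rewrite mul0r !mulr0 !addr0 card_nbrs_eq0 //; lia.
Qed.


Lemma distmx_adj0 : A *m A = (b 0)%:R%:M + alpha 1 *: A + (c 2)%:R *: D 2.
Proof. by rewrite -{1}distmx1 distmx_adjS //= distmx0 distmx1 scalemx1. Qed.

Lemma distmx_adj2 :
  D 2 *m A = (b 1)%:R *: A + alpha 2 *: D 2 + (c 3)%:R *: D 3.
Proof. by rewrite distmx_adjS //= distmx1. Qed.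

Lemma distmx_adj3 : D 3 *m A = (b 2)%:R *: D 2 + alpha 3 *: D 3.
Proof.
(* The recurrence closes here, since no two vertices are at distance 4. *)
rewrite distmx_adjS //= [D 4](_ : _ = 0) ?scaler0 ?addr0 //.
apply/matrixP => x y; rewrite !mxE.
by have := gdist_le3 x y; case: eqP => // ->.
Qed.

Lemma sum_distmx : 1%:M + A + D 2 + D 3 = ones.
Proof.
rewrite -distmx0 -distmx1; apply/matrixP => x y; rewrite !mxE.
by case: (d x y) (gdist_le3 x y) => [|[|[|[|//]]]] _;
   rewrite !eqE /= ?add0r ?addr0.
Qed.

Lemma adj_ones : A *m ones = (b 0)%:R *: ones.
Proof.
apply/matrixP => x y; rewrite !mxE mulr1 -(card_nbrs x) -sum1_card natr_sum.
rewrite [RHS]big_mkcond /=; apply: eq_bigr => z _.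
by rewrite !mxE inE mulr1; case: (e x z).
Qed.

Lemma tr_adj : A^T = A.
Proof. by apply/matrixP => x y; rewrite !mxE e_sym. Qed.

Lemma ones_adj : ones *m A = (b 0)%:R *: ones.
Proof.
have := congr1 trmx adj_ones.
by rewrite trmx_mul tr_adj linearZ /= trmx_const.
Qed.

Lemma adj_normal : A \is normalmx.
Proof.
apply/symmetric_normalmx.
  by apply/is_hermitianmxP; rewrite expr0 scale1r map_mx_id ?tr_adj.
by apply/mxOverP => x y; rewrite mxE realn.
Qed.

Lemma mxtrace_distmx i : (0 < i)%N -> \tr (D i) = 0.
Proof.
move=> i_gt0; apply: big1 => x _; rewrite mxE.
by rewrite (eqP (_ : d x x == 0%N)) ?gdist0 // ltn_eqF.
Qed.

Lemma mxtrace_adj : \tr A = 0.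
Proof. by rewrite -distmx1 mxtrace_distmx. Qed.

Lemma mxtrace_adj2 : \tr (A *m A) = n%:R * (b 0)%:R.
Proof.
rewrite distmx_adj0 !mxtraceD !mxtraceZ mxtrace_adj mxtrace_distmx //.
by rewrite mxtrace_scalar !mulr0 !addr0 mulr_natl.
Qed.

End Graph.

(** * Eigenvalues, multiplicities and p^3_33 *)

Section Eigen.

Variables (n : nat) (e : rel 'I_n) (b c : nat -> nat).
Hypothesis drg_e : drg_diam3 e b c.
Local Notation d := (gdist e).
Local Notation A := (adjmx e).
Local Notation D := (distmx e).
Local Notation alpha i := ((drg_a b c i)%:~R : algC).
Local Notation ones := (const_mx 1 : 'M[algC]_n).
Local Notation k := ((b 0)%:R : algC).
Local Notation b1 := ((b 1)%:R : algC).
Local Notation b2 := ((b 2)%:R : algC).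
Local Notation c2 := ((c 2)%:R : algC).
Local Notation c3 := ((c 3)%:R : algC).
(** This is c_2 times the eigenvalue of [D 2] on a t-eigenvector of [A]. Relations below are kept
    multiplied by c_2 or c_2 c_3 to avoid denominators. *)
Local Notation f t := (t ^+ 2 - alpha 1 * t - k).

Lemma scaler_vec_inj (v : 'rV[algC]_n) (s t : algC) :
  v != 0 -> s *: v = t *: v -> s = t.
Proof.
move=> v_neq0 /eqP; rewrite -subr_eq0 -scalerBl scaler_eq0 (negPf v_neq0) orbF.
by rewrite subr_eq0 => /eqP.
Qed.

Lemma eigen_dist2 (v : 'rV[algC]_n) t : v *m A = t *: v ->
  c2 *: (v *m D 2) = f t *: v.
Proof.
move=> vA; have := congr1 (mulmx v) (distmx_adj0 drg_e).
rewrite !mulmxDr mulmxA vA -scalemxAl vA mul_mx_scalar -!scalemxAr vA.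
move: (v *m _) => w /rowP E; apply/rowP => j; have := E j; rewrite !mxE => {}E.
transitivity (t * (t * v 0 j) - k * v 0 j - alpha 1 * (t * v 0 j)); last by ring.
by rewrite E; ring.
Qed.

Lemma eigen_dist3 (v : 'rV[algC]_n) t : v *m A = t *: v ->
  c2 * c3 *: (v *m D 3) = ((t - alpha 2) * f t - b1 * c2 * t) *: v.
Proof.
move=> vA; have v2 := eigen_dist2 vA.
have := congr1 (fun M => c2 *: (v *m M)) (distmx_adj2 drg_e).
rewrite mulmxA scalemxAl v2 -scalemxAl vA !mulmxDr -!scalemxAr vA.
move: (v *m D 2) (v *m D 3) v2 => w2 w3 /rowP v2 /rowP E; apply/rowP => j.
have := E j; have := v2 j; rewrite !mxE => {}v2 {}E.
transitivity (f t * (t * v 0 j) - b1 * c2 * t * v 0 j - alpha 2 * (c2 * w2 0 j)).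
  by rewrite E; ring.
by rewrite v2; ring.
Qed.

Lemma eigen_ones (v : 'rV[algC]_n) t : v *m A = t *: v -> t != k ->
  v *m ones = 0.
Proof.
move=> vA neq_tk; have := congr1 (mulmx v) (adj_ones drg_e).
rewrite mulmxA vA -scalemxAl -scalemxAr => /eqP.
rewrite -subr_eq0 -scalerBl scaler_eq0 subr_eq0 (negPf neq_tk) /=.
by move/eqP.
Qed.

(** An eigenvector for t != k is orthogonal to the all-ones vector, so the sum of the distance
    matrices kills it; this expresses [D 3] through [D 2] on it. Inserting this into the recurrence
    for [D 3] gives the cubic satisfied by theta_1, theta_2, theta_3. *)
Lemma eigenvalue_drg t : eigenvalue A t -> t != k ->
  (t - alpha 3) * (c2 * (1 + t) + f t) + b2 * f t = 0.
Proof.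
move=> /eigenvalueP[v vA v_neq0] neq_tk.
have v2 := eigen_dist2 vA.
have v3 : c2 *: (v *m D 3) = - (c2 * (1 + t) + f t) *: v.
  have := eigen_ones vA neq_tk; rewrite -(sum_distmx drg_e) !mulmxDr mulmx1 vA.
  move: (v *m D 2) (v *m D 3) v2 => w2 w3 /rowP v2 /rowP E; apply/rowP => j.
  have := E j; have := v2 j; rewrite !mxE => {}v2 {}E.
  transitivity (c2 * (v 0 j + t * v 0 j + w2 0 j + w3 0 j)
      - c2 * (1 + t) * v 0 j - c2 * w2 0 j); first by ring.
  by rewrite E v2; ring.
have := congr1 (fun M => c2 *: (v *m M)) (distmx_adj3 drg_e).
rewrite mulmxA scalemxAl v3 -scalemxAl vA !mulmxDr -!scalemxAr scalerDr.
rewrite !scalerA ![c2 * _]mulrC -!scalerA v2 v3 !scalerA -scalerDl.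
move/(scaler_vec_inj v_neq0)/eqP; rewrite eq_sym -subr_eq0 => /eqP <-; ring.
Qed.

(** The coefficient on the right is c_2 c_3 (1 + k + k_2 + k_3), where k_2 = k b_1 / c_2 and k_3 = k
    b_1 b_2 / (c_2 c_3) are the sizes of the distance spheres. *)
Lemma eigen_valency (v : 'rV[algC]_n) : v *m A = k *: v ->
  c2 * c3 *: (v *m ones) =
  (c2 * c3 * (1 + k) + c3 * k * b1 + k * b1 * b2) *: v.
Proof.
move=> vA; have v2 := eigen_dist2 vA; have v3 := eigen_dist3 vA.
have [[c1 _ _ _] _] := drg_params drg_e.
have a1E : alpha 1 = k - b1 - 1 by rewrite /drg_a c1 !rmorphB.
have a2E : alpha 2 = k - b2 - c2 by rewrite /drg_a !rmorphB.
rewrite -(sum_distmx drg_e) !mulmxDr mulmx1 vA.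
move: (v *m D 2) (v *m D 3) v2 v3 => w2 w3 /rowP v2 /rowP v3; apply/rowP => j.
have := v3 j; have := v2 j; rewrite !mxE => {}v2 {}v3.
transitivity (c2 * c3 * (1 + k) * v 0 j + c3 * (c2 * w2 0 j) + c2 * c3 * w3 0 j).
  by ring.
by rewrite v2 v3 a1E a2E; ring.
Qed.

Lemma drg_n_gt0 : (0 < n)%N.
Proof.
have [x _] := ex_path3 drg_e; exact: leq_ltn_trans (ltn_ord x).
Qed.

Lemma card_drg :
  c2 * c3 * n%:R = c2 * c3 * (1 + k) + c3 * k * b1 + k * b1 * b2.
Proof.
have vA : (const_mx 1 : 'rV[algC]_n) *m A = k *: const_mx 1.
  have := ones_adj drg_e => /matrixP E; apply/matrixP => i j.
  have := E (Ordinal drg_n_gt0) j; rewrite !mxE => <-.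
  by apply: eq_bigr => z _; rewrite !mxE.
have v_neq0 : (const_mx 1 : 'rV[algC]_n) != 0.
  apply/eqP => /matrixP/(_ 0 (Ordinal drg_n_gt0)); rewrite !mxE => /eqP.
  by rewrite oner_eq0.
apply: (scaler_vec_inj v_neq0); rewrite -(eigen_valency vA) -scalerA.
congr (_ *: _); apply/matrixP => i j; rewrite !mxE.
under [RHS]eq_bigr => z _ do rewrite !mxE mulr1.
by rewrite sumr_const card_ord mulr1.
Qed.

(** Combined with [card_drg], [eigen_valency] says that each k-eigenvector v satisfies v J = n v
    with J the all-ones matrix, so v is constant. *)
Lemma mult_valency : eigenvalue A k -> mult e k = 1%N.
Proof.
move=> eig_k; apply/eqP; rewrite eqn_leq [(1 <= _)%N]lt0n mxrank_eq0.
rewrite [X in _ && X]eig_k andbT.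
have [[_ _ c2_gt0 c3_gt0] _] := drg_params drg_e.
have cc_neq0 : c2 * c3 * n%:R != 0.
  by rewrite -!natrM pnatr_eq0 -lt0n !muln_gt0 c2_gt0 c3_gt0 drg_n_gt0.
suff /mxrankS : (eigenspace A k <= (const_mx 1 : 'rV[algC]_n))%MS.
  by move/leq_trans; apply; apply: rank_leq_row.
apply/rV_subP => v /eigenspaceP /eigen_valency; rewrite -card_drg => v_ones.
(* The 1 x 1 witness is the mean of the entries of v, with c_2 c_3 kept above and below to match
   [v_ones]. *)
apply/submxP; exists ((c2 * c3 * n%:R)^-1 *: (c2 * c3 *: (v *m const_mx 1))).
apply: (scalerI cc_neq0); rewrite -v_ones -!scalemxAl [RHS]scalerA divff // scale1r.
congr (_ *: _); rewrite -mulmxA; congr (_ *m _).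
by apply/matrixP => i j; rewrite !mxE big_ord1 !mxE mulr1.
Qed.

(* This says p^3_33 >= 0: for d(x, y) = 3 the row sum k_3 of D 3 is
   1 + a_3 + p^3_32 + p^3_33, and c_2 p^3_32 is read off D 3 *m A *m A. *)
Lemma p333_ge0 :
  c3 * (c2 * (1 + alpha 3) + b2 * c3 + alpha 3 ^+ 2 - alpha 1 * alpha 3 - k)
    <= k * b1 * b2.
Proof.
have [x [_ [_ [y [_ _ _ _ dxy]]]]] := ex_path3 drg_e.
have [[c1 _ _ _] _] := drg_params drg_e.
have a1E : alpha 1 = k - b1 - 1 by rewrite /drg_a c1 !rmorphB.
have a2E : alpha 2 = k - b2 - c2 by rewrite /drg_a !rmorphB.
have ones2 : c2 * (D 2 *m ones) x y = k * b1.
  have := congr1 (mulmxr ones) (distmx_adj0 drg_e); rewrite /=.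
  rewrite !mulmxDl -mulmxA -!scalemxAl !(adj_ones drg_e) -scalemxAr.
  rewrite (adj_ones drg_e) mul_scalar_mx.
  move: (D 2 *m _) => w /matrixP/(_ x y); rewrite !mxE => E.
  transitivity (k * (k * 1) - k * 1 - alpha 1 * (k * 1)); last by rewrite a1E; ring.
  by rewrite E; ring.
have ones3 : c2 * c3 * (D 3 *m ones) x y = k * b1 * b2.
  have := congr1 (mulmxr ones) (distmx_adj2 drg_e); rewrite /=.
  rewrite !mulmxDl -mulmxA -!scalemxAl (adj_ones drg_e) -scalemxAr.
  move: (D 3 *m _) (D 2 *m _) ones2 => w3 w2 ones2 /matrixP/(_ x y).
  rewrite !mxE => E.
  transitivity (c2 * (k * w2 x y) - c2 * b1 * (k * 1) - alpha 2 * (c2 * w2 x y)).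
    by rewrite E; ring.
  transitivity ((k - alpha 2) * (c2 * w2 x y) - c2 * b1 * k); first by ring.
  by rewrite ones2 a2E; ring.
have D3A : (D 3 *m A) x y = alpha 3.
  by rewrite (distmx_adj3 drg_e) !mxE dxy mulr0 mulr1 add0r.
have D3AA : (D 3 *m A *m A) x y = b2 * c3 + alpha 3 ^+ 2.
  rewrite (distmx_adj3 drg_e) mulmxDl -!scalemxAl (distmx_adj2 drg_e).
  rewrite (distmx_adj3 drg_e) !mxE -(gdist1 drg_e) dxy /=; ring.
have D32 : c2 * (D 3 *m D 2) x y = b2 * c3 + alpha 3 ^+ 2 - alpha 1 * alpha 3 - k.
  have := congr1 (mulmx (D 3)) (distmx_adj0 drg_e).
  rewrite mulmxA !mulmxDr mul_mx_scalar -!scalemxAr => /matrixP/(_ x y).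
  move: (D 3 *m A) (D 3 *m A *m A) (D 3 *m D 2) D3A D3AA => w31 w33 w32 D3A D3AA.
  rewrite !mxE D3A D3AA dxy mulr1 => ->; ring.
have D33 : 0 <= (D 3 *m D 3) x y.
  by rewrite mxE; apply: sumr_ge0 => z _; rewrite !mxE mulr_ge0 ?ler0n.
have D3ones : (D 3 *m ones) x y
    = 1 + alpha 3 + (D 3 *m D 2) x y + (D 3 *m D 3) x y.
  rewrite -(sum_distmx drg_e) !mulmxDr mulmx1 -D3A.
  by move: (_ *m A) (_ *m D 2) (_ *m D 3) => w1 w2 w3; rewrite !mxE dxy.
rewrite -ones3 D3ones -subr_ge0.
apply: le_trans (_ : 0 <= c2 * c3 * (D 3 *m D 3) x y) _.
  by rewrite !mulr_ge0 ?ler0n.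
(* A null term is added so that [D32] can replace one of its two copies; both sides then agree as
   polynomials. *)
rewrite -[X in X <= _]addr0 -[X in _ + X](subrr (c3 * (c2 * (D 3 *m D 2) x y))).
by rewrite {2}D32 le_eqVlt; apply/orP; left; apply/eqP; ring.
Qed.

End Eigen.

(** * Integer arithmetic of the parameters *)

Section Arith.

Variables a B b2 c2 : int.
Local Notation s := (a - B - b2 - c2).
Local Notation p := (B * b2 - a * B + c2).
(* [T] is [q a]. *)
Local Notation T := (b2 * (a + B) + (a + 1) * c2).
Local Notation S := (b2 + c2).
(** With N the number of vertices, (a + 1) Q = c_2 (N b_2 + T). *)
Local Notation Q := (S * (c2 + B * b2) + a * B * (B - 1) * b2).
Hypothesis B2 : 2 <= B.
Hypothesis aB : B <= a.
Hypothesis b2_gt0 : 0 < b2.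
Hypothesis c2_gt0 : 0 < c2.

(** [T0], [T1], [T2] are the traces of 1, A, A^2, and the last premise says q(k) = N c_2 for k = aB.
    The signs come from m s = -(aB + m_1 a) and from [upE]; multiplying [upE] and [lowE] crosswise
    eliminates m. *)
Lemma arith_spectrum (N m1 m : int) :
  0 <= m1 -> 0 <= m ->
  N = 1 + m1 + 2 * m ->
  a * B + m1 * a + m * s = 0 ->
  (a * B) ^+ 2 + m1 * a ^+ 2 + m * (s ^+ 2 - 2 * p) = N * (a * B) ->
  N * c2 = c2 * (1 + a * B) + a * B * (a + 1) * (B - 1) + B * (a + 1) * b2 ->
  [/\ s < 0, 0 < s + 2 * B & (s + 2 * B) * Q = - s * c2 * (B - 1) * (S + B * (a + 1))].
Proof.
move=> m1_ge0 m_ge0 T0 T1 T2 NE.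
have a_gt0 : 0 < a by apply: lt_le_trans aB; apply: lt_le_trans B2.
have B_gt0 : 0 < B by apply: lt_le_trans B2.
have a1_gt0 : 0 < a + 1 by apply: addr_gt0.
have B1_gt0 : 0 < B - 1 by rewrite subr_gt0; apply: lt_le_trans B2.
have aB_gt0 : 0 < a * B by rewrite mulr_gt0.
have S_gt0 : 0 < S by rewrite addr_gt0.
have ms : m * s = - (a * B + m1 * a).
  by rewrite -[LHS]subr0 -T1; ring.
have T_gt0 : 0 < T by rewrite addr_gt0 // mulr_gt0 // addr_gt0.
(* This is the trace of q(A): q vanishes at theta_2 and theta_3, leaving q(k) + m_1 q(a) = N (k +
   p). *)
have m1E : m1 * T = N * B * b2.
  have -> : N * B * b2 = N * p + N * (a * B) - N * c2 by ring.
  rewrite -T2 NE T0.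
  have -> : m * (s ^+ 2 - 2 * p) = s * (m * s) - 2 * p * m by ring.
  by rewrite ms; ring.
(* The last factor a (B - 1) (S + B (a + 1)) is q(k) - q(a) = N c_2 - T. *)
have upE : T * (m * (s + 2 * B)) =
    B * (a + 1) * (a * (B - 1) * (S + B * (a + 1))).
  transitivity (B * (a + 1) * (N * c2 - T)); last by rewrite NE; ring.
  transitivity (B * (T * N - T * (a + 1)) - (m1 * T) * (a + B)).
    by rewrite T0 [m * (_ + _)]mulrDr ms; ring.
  by rewrite m1E; ring.
have lowE : T * c2 * (m * - s) = a * B * (a + 1) * Q.
  transitivity (a * (m1 * T) * c2 + a * B * T * c2).
    by rewrite mulrN ms; ring.
  transitivity (a * B * b2 * (N * c2) + a * B * T * c2).
    by rewrite m1E; ring.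
  by rewrite NE; ring.
have s_lt0 : s < 0.
  rewrite ltNge; apply/negP => /(mulr_ge0 m_ge0); rewrite ms.
  by rewrite oppr_ge0 leNgt ltr_wpDr // mulr_ge0 // ltW.
have s2B_gt0 : 0 < s + 2 * B.
  have : 0 < T * (m * (s + 2 * B)).
    by rewrite upE !mulr_gt0 // addr_gt0 // mulr_gt0.
  rewrite pmulr_rgt0 // => ms2B_gt0; rewrite ltNge; apply/negP => s2B_le0.
  by have := mulr_ge0_le0 m_ge0 s2B_le0; rewrite leNgt ms2B_gt0.
split=> //.
have : a * B * (a + 1) != 0 by rewrite gt_eqF // mulr_gt0.
move/mulfI; apply.
transitivity ((s + 2 * B) * (T * c2 * (m * - s))); first by rewrite lowE; ring.
transitivity (- s * c2 * (T * (m * (s + 2 * B)))); first by ring.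
by rewrite upE; ring.
Qed.

(** The second premise is p^3_33 >= 0. If c_2 >= b_2 + B, it yields (a + 1) B <= b_2 (B - 1), while
    the first premise forces b_2 < a. *)
Lemma arith_c2_lt : S < a + B -> (a + 1) * c2 <= b2 * (a + B) ->  c2 < b2 + B.
Proof.
move=> lt_S le_c2; rewrite ltNge; apply/negP => le_b2B.
have : (a + 1) * (b2 + B) <= (a + 1) * c2 by rewrite ler_wpM2l //; lia.
have : b2 * (B - 1) <= a * (B - 1) by rewrite ler_wpM2r //; lia.
lia.
Qed.

Hypothesis E : (s + 2 * B) * Q = - s * c2 * (B - 1) * (S + B * (a + 1)).

Lemma arith_sum_eq : S = a -> 2 * a = B * (B - 1).
Proof.
move=> SE; have b2E : b2 = a - c2 by lia.
pose t := 2 * c2 - a; pose D := 2 * a - B * (B - 1).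
(* Here s = -B and s + 2B = B, so the relation [E] becomes linear in t. *)
have tE : t * (2 * a * (B ^+ 2 - 1) + B * (B - 1)) = a * D.
  have : B != 0 by lia.
  move/mulfI; apply; apply/eqP; rewrite -subr_eq0; apply/eqP.
  rewrite /t /D; move: E; rewrite b2E => /eqP; rewrite -subr_eq0 => /eqP E0.
  by rewrite -[RHS](mulr0 (-2)) -E0; ring.
have BB1_gt0 : 0 < B * (B - 1) by rewrite mulr_gt0 //; lia.
have BB2_gt0 : 0 < a * (B ^+ 2 - 1).
  by rewrite (_ : _ - _ = (B - 1) * (B + 1)) ?mulr_gt0 //; [lia..|ring].
have [t_lt0|t_gt0|t0] := ltgtP t 0.
(* As t <= -1, X is at most -aD = aB(B - 1) - 2a^2, although its first summand 2a(B - 1)(B + 1)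
   alone exceeds this. *)
- set X := 2 * a * _ + _ in tE.
  have : X <= - t * X by rewrite ler_peMl //; rewrite /X; lia.
  have : 0 < a * (B - 1) by rewrite mulr_gt0 //; lia.
  have : 0 <= a * a by apply: sqr_ge0.
  by rewrite mulNr tE /X /D; lia.
(* Collecting the multiples of a in [tE] leaves a u = t B (B - 1). Since u >= 1, a <= t B (B - 1);
   but u > 0 also gives a > t (B^2 - 1), which is larger. *)
- pose u := D - 2 * t * (B ^+ 2 - 1).
  have au : a * u = t * (B * (B - 1)) by rewrite /u mulrBr -tE; ring.
  have u_gt0 : 0 < u by rewrite -(@pmulr_rgt0 _ a) ?au ?mulr_gt0 //; lia.
  have : a <= a * u by rewrite ler_peMr //; lia.
  have : 0 < t * (B - 1) by rewrite mulr_gt0 //; lia.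
  by rewrite au; move: u_gt0; rewrite /u /D; lia.
- have /eqP : a * D = 0 by rewrite -tE t0 mul0r.
  by rewrite mulf_eq0 /D; lia.
Qed.

Lemma arith_eq : b2 = c2 -> s < 0 -> 0 < s + 2 * B -> 2 * a = B * (B - 1).
Proof.
move=> bcE s_lt0 s_gt.
pose w := 2 * c2 - a.
(* Here s = -B - w, so the bounds on s say |w| < B. The cofactor of w is then positive and too large
   for the left side unless w = 0. *)
have wE : 2 * a - B * (B - 1) = w * (2 * a * B + 2 * w + B - 3).
  have : B * c2 != 0 by rewrite mulf_neq0 //; lia.
  move/mulfI; apply; apply/eqP; rewrite -subr_eq0; apply/eqP.
  rewrite /w; move: E; rewrite bcE => /eqP; rewrite -subr_eq0 => /eqP E0.
  by rewrite -[RHS]E0; ring.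
have w_lt : w < B by lia.
have w_gt : - B < w by lia.
clearbody w.
have aBB : B * B <= a * B by rewrite ler_wpM2r //; lia.
have BB : 2 * B <= B * B by rewrite ler_wpM2r //; lia.
have [w_lt0|w_gt0|w0] := ltgtP w 0; last by rewrite w0 in wE; lia.
  have : 1 * (2 * a * B + 2 * w + B - 3) <= - w * (2 * a * B + 2 * w + B - 3).
    by rewrite ler_wpM2r //; lia.
  by lia.
have : 1 * (2 * a * B + 2 * w + B - 3) <= w * (2 * a * B + 2 * w + B - 3).
  by rewrite ler_wpM2r //; lia.
by have := ler_wpM2l (_ : 0 <= a) B2; lia.
Qed.

End Arith.

(** Subtracting the equations and cancelling x - y gives the sum, and adding them gives the sum of
    squares. The traces need only these symmetric functions because m_2 = m_3. *)
Lemma quad_roots (F : fieldType) (s p x y : F) : x != y ->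
  x ^+ 2 - s * x + p = 0 -> y ^+ 2 - s * y + p = 0 ->
  x + y = s /\ x ^+ 2 + y ^+ 2 = s ^+ 2 - 2 * p.
Proof.
move=> neq_xy qx qy; have sE : x + y = s.
  apply/eqP; rewrite -subr_eq0; apply/eqP.
  have : x - y != 0 by rewrite subr_eq0.
  move/mulfI; apply; rewrite mulr0.
  transitivity ((x ^+ 2 - s * x + p) - (y ^+ 2 - s * y + p)); first by ring.
  by rewrite qx qy subrr.
split=> //.
transitivity ((x ^+ 2 - s * x + p) + (y ^+ 2 - s * y + p) + s * (x + y) - 2 * p).
  by ring.
by rewrite qx qy sE; ring.
Qed.

(** * From the spectrum of the graph to the integer relations *)

Theorem theorem11 (n : nat) (e : rel 'I_n) (b c : nat -> nat)
    (th1 th2 th3 : algC) (bG : int) :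
  drg_diam3 e b c ->
  eigs_sorted e (b 0%N)%:R th1 th2 th3 ->
  (* Shilla: theta_1 = a_3 *)
  th1 = (drg_a b c 3)%:~R ->
  (* b(Gamma) = a_3 - a_1 = b >= 2 *)
  bG = drg_a b c 3 - drg_a b c 1 ->
  2 <= bG ->
  mult e th2 = mult e th3 ->
  [/\ drg_a b c 3 - bG < (b 2%N)%:Z + (c 2%N)%:Z,
      (b 2%N)%:Z + (c 2%N)%:Z < drg_a b c 3 + bG,
      (c 2%N)%:Z < (b 2%N)%:Z + bG &
      ((b 2%N)%:Z + (c 2%N)%:Z = drg_a b c 3 \/ b 2%N = c 2%N) ->
        2 * drg_a b c 3 = bG * (bG - 1)].
Proof.
move=> drg_e [lt32 lt21 lt1k eigs eigsP] th1E BE B2 mE.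
have [[c1 b2_gt0 c2_gt0 c3_gt0] [a1_ge0 a3_ge0]] := drg_params drg_e.
have lt2k := lt_trans lt21 lt1k; have lt31 := lt_trans lt32 lt21.
have eig1 : eigenvalue (adjmx e) th1 by rewrite eigs // !inE eqxx orbT.
have eig2 : eigenvalue (adjmx e) th2 by rewrite eigs // !inE eqxx !orbT.
have eig3 : eigenvalue (adjmx e) th3 by rewrite eigs // !inE eqxx !orbT.
have eigk : eigenvalue (adjmx e) (b 0%N)%:R by rewrite eigs // !inE eqxx.
set a := drg_a b c 3 in th1E BE a3_ge0 *.
have aE : drg_a b c 3 = a by []; clearbody a.
have a1E : drg_a b c 1 = a - bG by rewrite BE; ring.
(* At t = a_3 the cubic reduces to b_2 f(a_3) = 0, that is k = a_3 (a_3 - a_1). *)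
have kE : (b 0)%:Z = a * bG.
  have b2_neq0 : (b 2)%:R != 0 :> algC by rewrite pnatr_eq0 -lt0n.
  have := eigenvalue_drg drg_e eig1; rewrite aE (lt_eqF lt1k) => /(_ isT).
  rewrite th1E subrr mul0r add0r => /eqP; rewrite mulf_eq0 (negPf b2_neq0) /=.
  rewrite subr_eq0 eq_sym a1E => /eqP kE.
  by apply: (@intr_inj algC); rewrite -pmulrn kE; ring.
have c3E : (c 3)%:Z = a * (bG - 1).
  transitivity (a * bG - drg_a b c 3); last by rewrite aE; ring.
  by rewrite -kE /drg_a (b3_eq0 drg_e); ring.
have b1E : (b 1)%:Z = (a + 1) * (bG - 1).
  transitivity (a * bG - drg_a b c 1 - 1); last by rewrite a1E; ring.
  by rewrite -kE /drg_a c1; ring.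
have castb i : (b i)%:R = (b i)%:Z%:~R :> algC by rewrite pmulrn.
have castc i : (c i)%:R = (c i)%:Z%:~R :> algC by rewrite pmulrn.
set s : int := a - bG - (b 2)%:Z - (c 2)%:Z.
set p : int := bG * (b 2)%:Z - a * bG + (c 2)%:Z.
(* With k = aB the cubic factors as (t - a) q(t). *)
have root_q t : eigenvalue (adjmx e) t -> t < th1 ->
    t ^+ 2 - s%:~R * t + p%:~R = 0.
  move=> eig_t lt_t1; have := eigenvalue_drg drg_e eig_t.
  rewrite (lt_eqF (lt_trans lt_t1 lt1k)) => /(_ isT).
  rewrite a1E aE !castb !castc kE => E.
  have : t - a%:~R != 0 by rewrite subr_eq0 -th1E (lt_eqF lt_t1).
  by move/mulfI; apply; rewrite mulr0 -[RHS]E /s /p; ring.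
have [sE s2E] := quad_roots (negbT (gt_eqF lt32))
  (root_q _ eig2 lt21) (root_q _ eig3 lt31).
have uniq_ts : uniq [:: (b 0)%:R; th1; th2; th3].
  rewrite /= !inE !negb_or !gt_eqF //; exact: lt_trans lt31 lt1k.
have [T0 T1 T2] := tr_normal (adj_normal drg_e) uniq_ts eigsP.
move: T0 T1 T2; rewrite !big_cons !big_nil.
rewrite -![\rank _]/(mult e _) (mult_valency drg_e) // -mE.
rewrite (mxtrace_adj drg_e) (mxtrace_adj2 drg_e).
rewrite -(mulr_natr th1) -(mulr_natr th2) -(mulr_natr th3).
rewrite -(mulr_natr (th1 ^+ 2)) -(mulr_natr (th2 ^+ 2)) -(mulr_natr (th3 ^+ 2)).
rewrite !mulr1n !addr0; set m1 := mult e th1; set m := mult e th2 => T0 T1 T2.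
(* The trace identities are moved from [algC] to the integers, where divisibility and size arguments
   apply. *)
have iT0 : n%:Z = 1 + m1%:Z + 2 * m%:Z.
  apply: (@intr_inj algC); rewrite -pmulrn T0; ring.
have iT1 : a * bG + m1%:Z * a + m%:Z * s = 0.
  apply: (@intr_inj algC); rewrite [RHS]T1.
  transitivity ((b 0)%:R + th1 * m1%:R + (th2 + th3) * m%:R); last by ring.
  by rewrite sE th1E castb kE; ring.
have iT2 : (a * bG) ^+ 2 + m1%:Z * a ^+ 2 + m%:Z * (s ^+ 2 - 2 * p) =
    n%:Z * (a * bG).
  apply: (@intr_inj algC); rewrite -[in RHS]kE intrM -!pmulrn T2.
  transitivity ((b 0)%:R ^+ 2 + th1 ^+ 2 * m1%:R + (th2 ^+ 2 + th3 ^+ 2) * m%:R);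
    last by ring.
  by rewrite s2E th1E castb kE; ring.
have b2Z_gt0 : 0 < (b 2)%:Z by [].
have c2Z_gt0 : 0 < (c 2)%:Z by [].
have c3Z_gt0 : 0 < (c 3)%:Z by [].
have c3_neq0 : (c 3)%:Z != 0 by rewrite gt_eqF.
have iN : n%:Z * (c 2)%:Z = (c 2)%:Z * (1 + a * bG)
    + a * bG * (a + 1) * (bG - 1) + bG * (a + 1) * (b 2)%:Z.
  have iC : (c 2)%:Z * (c 3)%:Z * n%:Z = (c 2)%:Z * (c 3)%:Z * (1 + (b 0)%:Z)
      + (c 3)%:Z * (b 0)%:Z * (b 1)%:Z + (b 0)%:Z * (b 1)%:Z * (b 2)%:Z.
    apply: (@intr_inj algC); rewrite !(intrD, intrM) -!pmulrn; exact: card_drg drg_e.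
  apply: (mulfI c3_neq0); transitivity ((c 2)%:Z * (c 3)%:Z * n%:Z); first by ring.
  by rewrite iC kE b1E c3E; ring.
(* After substituting k, b_1 and c_3, the two sides of [p333_ge0] differ by c_3 times the difference
   of these. *)
have p333 : (a + 1) * (c 2)%:Z <= (b 2)%:Z * (a + bG).
  have : (c 3)%:Z * ((c 2)%:Z * (1 + a) + (b 2)%:Z * (c 3)%:Z + a ^+ 2
      - drg_a b c 1 * a - (b 0)%:Z) <= (b 0)%:Z * (b 1)%:Z * (b 2)%:Z.
    rewrite -(ler_int algC); move: (p333_ge0 drg_e).
    by rewrite aE !castb !castc; congr (_ <= _); ring.
  move=> le_p333; rewrite -(ler_pM2l c3Z_gt0) -subr_ge0; move: le_p333.
  by rewrite -subr_ge0 a1E kE b1E c3E; congr (0 <= _); ring.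
have le_Ba : bG <= a by rewrite -subr_ge0 -a1E.
have [s_lt0 s_gt E] :=
  arith_spectrum B2 le_Ba b2Z_gt0 c2Z_gt0 (erefl : 0 <= m1%:Z)
    (erefl : 0 <= m%:Z) iT0 iT1 iT2 iN.
have lt_sum : (b 2)%:Z + (c 2)%:Z < a + bG.
  by rewrite -subr_gt0; move: s_gt; congr (0 < _); ring.
split=> //.
- by rewrite -subr_gt0 -oppr_lt0; move: s_lt0; congr (_ < 0); rewrite /s; ring.
- exact: arith_c2_lt p333.
- case=> [sumE|/(congr1 Posz) bcE].
    exact: (arith_sum_eq B2 le_Ba b2Z_gt0 c2Z_gt0 E).
  exact: (arith_eq B2 le_Ba b2Z_gt0 c2Z_gt0 E).
Qed.
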